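(* Let $\alpha \in (0,1)$ be an algebraic number with minimal polynomial $m_\alpha(x) \in \mathbb{Q}[x]$. The following conditions are equivalent. (a) $M_\alpha$ is a simple antimatter monoid (that is, $M_\alpha$ is simple and antimatter). (b) $\alpha^{-1}$ is a Perron number and has no positive conjugate aside from itself. (c) $\alpha^{-1}$ is a Perron number and $m_\alpha(x)$ has a simple multiple $p(x) \in x\mathbb{N}_0[x]-1$.
   Context: $\mathbb{N} = \{1,2,\dots\}$, $\mathbb{N}_0 = \mathbb{N}\cup\{0\}$; $\mathbb{N}_0[x]$ is the set of polynomials with nonnegative integer coefficients, and $x\mathbb{N}_0[x]-1 := \{x f(x) - 1 : f(x) \in \mathbb{N}_0[x]\}$. For $\alpha \in \mathbb{C}$, $M_\alpha := \{p(\alpha) : p(x) \in \mathbb{N}_0[x]\}$, viewed as a (cancellative commutative) monoid under addition. An atom of an additively written monoid $M$ is a non-invertible element $a \in M$ such that $a = b+c$ with $b,c \in M$ implies that $b$ or $c$ is invertible in $M$. A monoid is antimatter if it has no atoms. A nonconstant polynomial $f(x) \in \mathbb{Q}[x]$ is simple if the only pair $(n,g(x)) \in \mathbb{N} \times \mathbb{Q}[x]$ with $f(x) = g(x^n)$ is $(1,f(x))$. For algebraic $\alpha$, the monoid $M_\alpha$ is called simple if the minimal polynomial $m_\alpha(x)$ is simple. ''Multiple'' means multiple in $\mathbb{Q}[x]$. A Perron number is a real algebraic integer greater than $1$ that strictly exceeds each of its other algebraic conjugates (over $\mathbb{Q}$) in absolute value. *)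

(* Defs.v *)
From HB Require Import structures.
From mathcomp Require Import all_boot all_order all_algebra all_field.

Set Implicit Arguments.
Unset Strict Implicit.
Unset Printing Implicit Defensive.

Import Order.TTheory GRing.Theory Num.Theory.
Local Open Scope ring_scope.

(* A submonoid of an additive commutative monoid V is given by its membership
   predicate M : V -> Prop; invertibility and atoms are relative to M. *)
Section Atoms.
Variables (V : nmodType) (M : V -> Prop).

Definition invertible_in (a : V) : Prop :=
  M a /\ exists b, M b /\ a + b = 0.

Definition atom_of (a : V) : Prop :=
  [/\ M a, ~ invertible_in a
    & forall b c, M b -> M c -> a = b + c ->
        invertible_in b \/ invertible_in c].

Definition antimatter : Prop := forall a, ~ atom_of a.

End Atoms.

(* N_0[x] is {poly nat}; natpoly R maps it to {poly R}. *)
Definition natpoly (R : nzRingType) (f : {poly nat}) : {poly R} :=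
  map_poly (fun n : nat => n%:R) f.

Definition monoidM (alpha : algC) (z : algC) : Prop :=
  exists p : {poly nat}, z = (natpoly algC p).[alpha].

Definition in_xN0x_minus1 (p : {poly rat}) : Prop :=
  exists f : {poly nat}, p = 'X * natpoly rat f - 1.

(* g(x^n) is g \Po 'X^n; the pair (1, f) itself always satisfies the equation. *)
Definition simple_poly (f : {poly rat}) : Prop :=
  (1 < size f)%N /\
  forall (n : nat) (g : {poly rat}),
    (0 < n)%N -> f = g \Po 'X^n -> n = 1%N /\ g = f.

(* The library's minCpoly is the image of the minimal polynomial in
   {poly algC}; this is the underlying polynomial over the rationals. *)
Definition minQpoly (alpha : algC) : {poly rat} := s2val (minCpolyP alpha).

Lemma minQpolyP (alpha : algC) :
  [/\ minCpoly alpha = map_poly ratr (minQpoly alpha),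
      minQpoly alpha \is monic
    & forall q : {poly rat},
        root (map_poly ratr q) alpha = (minQpoly alpha %| q)].
Proof. by rewrite /minQpoly; case: (minCpolyP alpha) => p /= []. Qed.

Lemma monoidM0 (alpha : algC) : monoidM alpha 0.
Proof. by exists 0; rewrite /natpoly map_poly0 horner0. Qed.

Lemma monoidMD (alpha y z : algC) :
  monoidM alpha y -> monoidM alpha z -> monoidM alpha (y + z).
Proof.
move=> [p ->] [q ->]; exists (p + q); rewrite -hornerD; congr (_.[_]).
apply/polyP=> i; rewrite coefD !coef_map_id0 // coefD.
by rewrite -natrD.
Qed.

Definition simple_monoidM (alpha : algC) : Prop := simple_poly (minQpoly alpha).

Definition conjugate (alpha z : algC) : bool := root (minCpoly alpha) z.

(* On algC, 1 < b entails that b is real. *)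
Definition perron (b : algC) : Prop :=
  [/\ b \in Aint, 1 < b
    & forall z, conjugate b z -> z != b -> `|z| < b].

(* Main.v *)
(* If M_x is antimatter, 1 is not an atom, so x f(x) = 1 with f in N_0[x]. Then
   x^-1 is integral and every conjugate z of x satisfies |z| >= x, with z^g = x^g
   for some g > 0 in case of equality; simplicity of the minimal polynomial
   excludes z <> x by a Galois argument.

   Conversely, let b = x^-1 be Perron without other positive conjugates, with
   minimal polynomial m. As m / (X - b) has no root in [0, +oo[, it has a real
   multiple F with all coefficients positive and F(b) = 1. The integral remainder
   of X^n modulo m is b^n L + o(b^n), where L is the multiple of m / (X - b) with
   L(b) = 1; since F - L = t m, adding m times the rounding of b^n t turns it into
   an integral polynomial b^n F + o(b^n), whose coefficients are positive for
   large n and whose value at b is b^n. *)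
Require Import Defs.
From mathcomp Require Import all_boot all_order all_algebra all_field.
From HB Require Import structures.
From mathcomp Require Import ring.
From Stdlib Require Import Classical.

Set Implicit Arguments.
Unset Strict Implicit.
Unset Printing Implicit Defensive.

Import Order.TTheory GRing.Theory Num.Theory.
Local Open Scope ring_scope.

(** * Conjugates and automorphisms of the algebraic numbers *)

(** The roots of [minCpoly x] generate a number field that is the splitting field of a rational
    polynomial, hence normal; its automorphisms act transitively on the roots of a minimal
    polynomial and extend to [algC]. *)
Lemma conjugate_aut (x z : algC) :
  conjugate x z -> exists nu : {rmorphism algC -> algC}, nu x = z.
Proof.
rewrite /conjugate => xz.
have [p [Dp mon_p] min_p] := minCpolyP x.
have [rs Drs] := closed_field_poly_normal (minCpoly x).
rewrite (monicP (minCpoly_monic x)) scale1r in Drs.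
have [Qs [QsC [s1 Ds1 genQs]]] := num_field_exists rs.
have QsC_alg (q : {poly rat}) :
    map_poly QsC (map_poly (in_alg Qs) q) = map_poly ratr q.
  rewrite -map_poly_comp; apply: eq_map_poly => a /=.
  by rewrite rmorphZ_num rmorph1 mulr1.
have Qpol (q : {poly rat}) : map_poly (in_alg Qs) q \is a polyOver 1%VS.
  by apply/polyOverP=> i; rewrite coef_map /= rpredZ ?mem1v.
have Ds : map_poly (in_alg Qs) p = \prod_(w <- s1) ('X - w%:P).
  apply: (map_poly_inj QsC); rewrite QsC_alg -Dp Drs -Ds1 big_map rmorph_prod.
  by apply: eq_bigr => i _ /=; rewrite map_polyXsubC.
have Qs_ax : FieldExt_isSplittingField _ Qs.
  constructor; exists (map_poly (in_alg Qs) p) => //.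
  by exists s1 => //; rewrite Ds eqpxx.
pose Qn : splittingFieldType rat := HB.pack_for (splittingFieldType rat) Qs Qs_ax.
have [u Du] : exists2 u, u \in s1 & x = QsC u.
  by apply/mapP; rewrite Ds1 -root_prod_XsubC -Drs root_minCpoly.
have [v Dv] : exists2 v, v \in s1 & z = QsC v.
  by apply/mapP; rewrite Ds1 -root_prod_XsubC -Drs.
move=> Ev Eu.
(* [minPoly 1 u] has rational coefficients and its image vanishes at [x], so [p] divides it and [v]
   is one of its roots. *)
have uv : root (minPoly 1 (u : Qn)) v.
  have [q Dq] : exists q : {poly rat},
      minPoly 1 (u : Qn) = map_poly (in_alg Qs) q.
    have aP i: (minPoly 1 (u : Qn))`_i \in 1%VS.
      by apply/polyOverP; apply: minPolyOver.
    have a_ i := sig_eqW (vlineP _ _ (aP i)).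
    exists (\poly_(i < size (minPoly 1 (u : Qn))) sval (a_ i)).
    apply/polyP=> i; rewrite coef_map coef_poly /=.
    case: ifP => [_ | /negbT]; first by case: (a_ i).
    by rewrite -leqNgt => /leq_sizeP->; rewrite ?scale0r.
  have := root_minPoly 1 (u : Qn); rewrite Dq -(fmorph_root QsC) QsC_alg.
  rewrite -Eu min_p => /dvdpP[r Dr].
  by rewrite -(fmorph_root QsC) QsC_alg Dr rmorphM rootM /= -Dp -Ev xz orbT.
have [phi _ phi_u] :=
  normalField_root_minPoly (sub1v _) (normalFieldf (L := Qn) 1) (memvf _) uv.
have [nu Dnu] := extend_algC_subfield_aut QsC (phi : {rmorphism Qn -> Qn}).
by exists nu; rewrite Eu Ev -Dnu; congr (QsC _).
Qed.

Lemma aut_conjugate (nu : {rmorphism algC -> algC}) (x : algC) :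
  conjugate x (nu x).
Proof. by rewrite /conjugate -(minCpoly_aut nu) root_minCpoly. Qed.

Lemma conjugate_inv (x z : algC) : conjugate x z -> conjugate x^-1 z^-1.
Proof.
by move=> /conjugate_aut[nu <-]; rewrite -fmorphV; apply: aut_conjugate.
Qed.

Lemma conjugate_invl (x z : algC) : conjugate x^-1 z -> conjugate x z^-1.
Proof. by move=> /conjugate_inv; rewrite invrK. Qed.

Lemma minQpoly_neq0 (x : algC) : minQpoly x != 0.
Proof. by have [_ /monic_neq0] := minQpolyP x. Qed.

Lemma size_minQpoly (x : algC) : size (minQpoly x) = size (minCpoly x).
Proof. by have [-> _ _] := minQpolyP x; rewrite size_map_poly. Qed.

(** Write [p] as [u] times its gcd with its derivative; [x] is a root of one factor. Either [p]
    divides [u] and the gcd is constant, or [p] divides its own derivative, which is nonzero and of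
    smaller degree. *)
Lemma minCpoly_separable (x : algC) : separable_poly (minCpoly x).
Proof.
have [Dp mon_p min_p] := minQpolyP x; set p := minQpoly x in Dp mon_p min_p.
have p0 : p != 0 := minQpoly_neq0 x.
have sz_p : (1 < size p)%N by rewrite /p size_minQpoly size_minCpoly.
rewrite Dp separable_map unlock.
have /dvdpP[u Du] := dvdp_gcdl p p^`().
have : root (map_poly ratr p) x by rewrite min_p dvdpp.
rewrite {1}Du rmorphM rootM /= !min_p => /orP[p_u|p_gcd].
  have u0 : u != 0 by apply: contraNneq p0 => u0; rewrite Du u0 mul0r.
  have := dvdp_leq u0 p_u; rewrite {1}Du size_mul //; last first.
    by rewrite gcdp_eq0 (negPf p0).
  rewrite coprimep_def.
  have : (0 < size (gcdp p p^`()))%N by rewrite lt0n size_poly_eq0 gcdp_eq0 (negPf p0).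
  case: (size _) => // n _; rewrite addnS /= -[X in (_ <= X)%N]addn0 leq_add2l.
  by rewrite leqn0 => /eqP->.
have d0 : p^`() != 0.
  apply/eqP=> /(congr1 (fun q : {poly rat} => q`_(size p).-2)) /eqP.
  rewrite coef_deriv coef0 -mulr_natr mulf_eq0 pnatr_eq0 orbF.
  have -> : (size p).-2.+1 = (size p).-1 by case: (size p) sz_p => [|[]].
  by rewrite -/(lead_coef p) lead_coef_eq0 (negPf p0).
have := dvdp_leq d0 (dvdp_trans p_gcd (dvdp_gcdr _ _)).
by rewrite leqNgt lt_size_deriv.
Qed.

Lemma minCpoly_roots (x : algC) :
  exists2 rs : seq algC, uniq rs & minCpoly x = \prod_(w <- rs) ('X - w%:P).
Proof.
have [rs Drs] := closed_field_poly_normal (minCpoly x).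
rewrite (monicP (minCpoly_monic x)) scale1r in Drs.
exists rs => //; rewrite -separable_prod_XsubC -Drs.
exact: minCpoly_separable.
Qed.

Lemma conjugate0 (x z : algC) : x != 0 -> conjugate x z -> z != 0.
Proof. by move=> x0 /conjugate_aut[nu <-]; rewrite fmorph_eq0. Qed.

(** * Polynomials with natural coefficients, the monoid and its atoms *)

Lemma natpoly_horner (R : nzRingType) (f : {poly nat}) (x : R) :
  (natpoly R f).[x] = \sum_(i < size f) (f`_i)%R%:R * x ^+ i.
Proof.
rewrite (@horner_coef_wide _ (size f)).
  by apply: eq_bigr => i _; rewrite coef_map_id0.
by rewrite size_poly.
Qed.

Lemma natpolyM (R : nzRingType) (f g : {poly nat}) :
  natpoly R (f * g) = natpoly R f * natpoly R g.
Proof.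
apply/polyP=> i; rewrite coef_map_id0 // !coefM raddf_sum; apply: eq_bigr => j _.
by rewrite !coef_map_id0 // /= natrM.
Qed.

Lemma natpolyD (R : nzRingType) (f g : {poly nat}) :
  natpoly R (f + g) = natpoly R f + natpoly R g.
Proof.
by apply/polyP=> i; rewrite coefD !coef_map_id0 // coefD natrD.
Qed.

Lemma natpolyXn (R : nzRingType) (n : nat) : natpoly R 'X^n = 'X^n.
Proof.
by apply/polyP=> i; rewrite coef_map_id0 // !coefXn; case: (i == n).
Qed.

Lemma natpoly_ge0 (x : algC) (f : {poly nat}) : 0 <= x -> 0 <= (natpoly algC f).[x].
Proof.
move=> x0; rewrite natpoly_horner sumr_ge0 // => i _.
by rewrite mulr_ge0 ?ler0n ?exprn_ge0.
Qed.

Lemma monoidM_ge0 (x y : algC) : 0 <= x -> monoidM x y -> 0 <= y.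
Proof. by move=> x0 [f ->]; apply: natpoly_ge0. Qed.

Lemma invertible_monoidM (x y : algC) :
  0 <= x -> invertible_in (monoidM x) y -> y = 0.
Proof.
move=> x0 [My [z [Mz yz]]]; apply/eqP; move/eqP: yz.
by rewrite (paddr_eq0 (monoidM_ge0 x0 My) (monoidM_ge0 x0 Mz)) => /andP[].
Qed.

Lemma monoidM_mul (x y z : algC) : monoidM x y -> monoidM x z -> monoidM x (y * z).
Proof. by move=> [f ->] [g ->]; exists (f * g); rewrite natpolyM hornerM. Qed.

Lemma monoidMXn (x : algC) n : monoidM x (x ^+ n).
Proof. by exists 'X^n; rewrite natpolyXn hornerXn. Qed.

Lemma natpoly_ge1 (x : algC) (f : {poly nat}) :
  0 <= x -> f`_0 != 0%N -> 1 <= (natpoly algC f).[x].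
Proof.
move=> x0 f0; have szf : (0 < size f)%N.
  by rewrite lt0n size_poly_eq0; apply: contraNneq f0 => ->; rewrite coef0.
rewrite natpoly_horner (bigD1 (Ordinal szf)) //= expr0 mulr1.
apply: (le_trans (y := (f`_0)%R%:R)); first by rewrite ler1n lt0n.
by rewrite lerDl sumr_ge0 // => i _; rewrite mulr_ge0 ?ler0n ?exprn_ge0.
Qed.

Lemma natpoly_split0 (f : {poly nat}) :
  f`_0 = 0%N -> exists g : {poly nat}, f = g * 'X.
Proof.
move=> f0; exists (\poly_(i < size f) f`_i.+1).
apply/polyP=> -[|i]; rewrite coefMX //= coef_poly.
case: ltnP => // /leqW/leq_sizeP -> //.
Qed.

(** In a decomposition 1 = f(x) + g(x), a summand with nonzero constant term is at least 1, so the
    other one vanishes. As 1 is not an atom, some decomposition has both constant terms zero, and x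
    factors out of it. *)
Lemma antimatter_root (x : algC) :
    0 < x -> antimatter (monoidM x) ->
  exists f : {poly nat}, x * (natpoly algC f).[x] = 1.
Proof.
move=> x_gt0 antiM; have x0 := ltW x_gt0; apply: NNPP => no_f.
apply: (antiM 1); split.
- by rewrite -(expr0 x); apply: monoidMXn.
- by move/(invertible_monoidM x0)/eqP; rewrite oner_eq0.
move=> _ _ [f ->] [g ->] Dfg.
have inv0 h : (natpoly algC h).[x] = 0 -> invertible_in (monoidM x) (natpoly algC h).[x].
  move=> ->; split; first exact: monoidM0.
  by exists 0; rewrite addr0; split=> //; apply: monoidM0.
have [f0|f0] := eqVneq f`_0 0%N; last first.
  right; apply: inv0; apply: le_anti; rewrite natpoly_ge0 // andbT.
  by rewrite -(lerD2l (natpoly algC f).[x]) -Dfg addr0 natpoly_ge1.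
have [g0|g0] := eqVneq g`_0 0%N; last first.
  left; apply: inv0; apply: le_anti; rewrite natpoly_ge0 // andbT.
  by rewrite -(lerD2r (natpoly algC g).[x]) -Dfg add0r natpoly_ge1.
have [[u Du] [v Dv]] := (natpoly_split0 f0, natpoly_split0 g0).
case: no_f; exists (u + v); rewrite Dfg Du Dv !natpolyM natpolyD !hornerM hornerD.
by rewrite -(expr1 'X) natpolyXn hornerXn expr1 mulrDr !(mulrC x).
Qed.

(** Splitting one leading monomial off x f(x) writes 1 as a sum of two elements of the monoid, both
    nonzero because x < 1. Multiplying by a nonzero [a] decomposes [a]. *)
Lemma root_antimatter (x : algC) (f : {poly nat}) :
  0 < x -> x < 1 -> x * (natpoly algC f).[x] = 1 -> antimatter (monoidM x).
Proof.
move=> x_gt0 x_lt1 fx1 a [Ma a_inv a_atom]; have x0 := ltW x_gt0.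
have a0 : a != 0.
  apply/eqP=> Da; case: a_inv; split=> //.
  by exists 0; rewrite Da addr0; split=> //; apply: monoidM0.
have f0 : f != 0.
  apply/eqP=> Df; move/eqP: fx1; rewrite Df /natpoly map_poly0 horner0 mulr0.
  by rewrite eq_sym oner_eq0.
pose n := (size f).-1.
(* Only the leading coefficient is lowered; it is positive, so the truncated subtraction is
   exact. *)
pose h : {poly nat} := \poly_(i < size f) ((f`_i)%R - (i == n))%N.
have Df : f = h + 'X^n.
  apply/polyP=> i; rewrite coefD coefXn coef_poly.
  case: ltnP => [|fi]; last first.
    rewrite nth_default // gtn_eqF //= (leq_trans _ fi) // prednK //.
    by rewrite lt0n size_poly_eq0.
  have [->|ni] := eqVneq i n; last by rewrite subn0 addr0.
  by rewrite [RHS]subnK // lt0n -/(lead_coef f) lead_coef_eq0.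
have Mxn : monoidM x (x ^+ n.+1) by apply: monoidMXn.
have Mxh : monoidM x (x * (natpoly algC h).[x]).
  by apply: monoidM_mul; [rewrite -(expr1 x); apply: monoidMXn | exists h].
have D1 : x * (natpoly algC h).[x] + x ^+ n.+1 = 1.
  by rewrite -fx1 Df natpolyD natpolyXn hornerD hornerXn mulrDr exprS.
have Da : a = a * (x * (natpoly algC h).[x]) + a * x ^+ n.+1.
  by rewrite -mulrDr D1 mulr1.
have [] := a_atom _ _ (monoidM_mul Ma Mxh) (monoidM_mul Ma Mxn) Da.
  move/(invertible_monoidM x0)/eqP; rewrite mulf_eq0 (negPf a0) /= => /eqP hx0.
  move/eqP: D1; rewrite hx0 add0r => /eqP Dxn.
  by have := exprn_ilt1 n.+1 x0 x_lt1; rewrite Dxn ltxx.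
move/(invertible_monoidM x0)/eqP; rewrite mulf_eq0 (negPf a0) expf_eq0 /=.
by rewrite (gt_eqF x_gt0).
Qed.

(** * Conjugates of a positive root of x f(x) = 1 *)

Lemma aut_natpoly (nu : {rmorphism algC -> algC}) (f : {poly nat}) (x : algC) :
  nu (natpoly algC f).[x] = (natpoly algC f).[nu x].
Proof.
rewrite !natpoly_horner rmorph_sum; apply: eq_bigr => i _.
by rewrite rmorphM rmorphXn /= rmorph_nat.
Qed.

Lemma mulX_natpolyE (f : {poly nat}) (x : algC) :
  x * (natpoly algC f).[x] = \sum_(i < size f) (f`_i)%R%:R * x ^+ i.+1.
Proof.
rewrite natpoly_horner mulr_sumr; apply: eq_bigr => i _.
by rewrite mulrCA exprS.
Qed.

Lemma natpoly_root_neq0 (f : {poly nat}) (x : algC) :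
  x * (natpoly algC f).[x] = 1 -> f != 0.
Proof.
move=> fx1; apply/eqP=> Df; move/eqP: fx1.
by rewrite Df /natpoly map_poly0 horner0 mulr0 eq_sym oner_eq0.
Qed.

Lemma mulX_natpoly_lt (f : {poly nat}) (x y : algC) :
  f != 0 -> 0 <= x -> x < y ->
  x * (natpoly algC f).[x] < y * (natpoly algC f).[y].
Proof.
move=> f0 x0 xy; have szf : ((size f).-1 < size f)%N.
  by rewrite prednK // lt0n size_poly_eq0.
rewrite !mulX_natpolyE (bigD1 (Ordinal szf)) //= [ltRHS](bigD1 (Ordinal szf)) //=.
apply: ltr_leD.
  rewrite ltr_pM2l; first by rewrite ltrXn2r ?(ltW (le_lt_trans x0 xy)).
  by rewrite ltr0n lt0n -/(lead_coef f) lead_coef_eq0.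
apply: ler_sum => i _; rewrite ler_wpM2l ?ler0n // lerXn2r // ?nnegrE ?ltW //.
exact: le_lt_trans x0 xy.
Qed.

Section PositiveRoot.

Variables (x : algC) (f : {poly nat}).
Hypotheses (x_gt0 : 0 < x) (fx1 : x * (natpoly algC f).[x] = 1).

Lemma conjugate_natpoly z : conjugate x z -> z * (natpoly algC f).[z] = 1.
Proof.
by move=> /conjugate_aut[nu <-]; rewrite -aut_natpoly -rmorphM fx1 rmorph1.
Qed.

(** If |z| < x, then 1 = |z f(z)| <= |z| f(|z|) < x f(x) = 1. *)
Lemma conjugate_norm_ge z : conjugate x z -> x <= `|z|.
Proof.
move=> /conjugate_natpoly fz1.
rewrite real_leNgt ?normr_real ?gtr0_real //; apply/negP=> zx.
have := mulX_natpoly_lt (natpoly_root_neq0 fx1) (normr_ge0 z) zx.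
rewrite fx1 => /lt_geF/negP; apply.
rewrite -(normr1 algC) -{1}fz1 !mulX_natpolyE.
apply: le_trans (ler_norm_sum _ _ _) _; apply: ler_sum => i _.
by rewrite normrM normrX normr_nat.
Qed.

(** This is the equality case of the triangle inequality: the terms of z f(z) have the moduli of
    those of x f(x) and the same sum, so they agree one by one. *)
Lemma conjugate_norm_eq z k :
  conjugate x z -> `|z| = x -> f`_k != 0%N -> z ^+ k.+1 = x ^+ k.+1.
Proof.
move=> /conjugate_natpoly fz1 zx fk.
have szk : (k < size f)%N.
  by rewrite ltnNge; apply: contra fk => /leq_sizeP->.
have := @normC_sum_upper _ 'I_(size f) predT
  (fun i => (f`_i)%R%:R * z ^+ i.+1) (fun i => (f`_i)%R%:R * x ^+ i.+1).
move=> /(_ _ _ (Ordinal szk) isT) H; apply: (mulfI (x := (f`_k)%R%:R)).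
  by rewrite pnatr_eq0.
apply: H => [i _|]; first by rewrite normrM normrX normr_nat zx.
by rewrite -!mulX_natpolyE fx1.
Qed.

Lemma conjugate_pos_eq z : conjugate x z -> 0 < z -> z = x.
Proof.
move=> xz z0; have := conjugate_norm_ge xz; rewrite (ger0_norm (ltW z0)).
rewrite le_eqVlt => /orP[/eqP-> //|].
move=> /(mulX_natpoly_lt (natpoly_root_neq0 fx1) (ltW x_gt0)).
by rewrite fx1 conjugate_natpoly // ltxx.
Qed.

(** Dividing x f(x) = 1 by x^n, with n the size of f, gives a monic integral equation for the
    inverse of x; [q] is f with its coefficients reversed. *)
Lemma natpoly_root_Aint : x^-1 \in Aint.
Proof.
pose n := size f.
pose q : {poly algC} := \poly_(j < n) (f`_(n - j.+1)%N)%R%:R.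
have szq : (size q < size ('X^n : {poly algC}))%N.
  by rewrite size_polyXn ltnS size_poly.
apply: (@root_monic_Aint ('X^n - q)).
- apply/rootP; rewrite hornerD hornerXn hornerN (@horner_coef_wide _ n) ?size_poly //.
  apply/eqP; rewrite subr_eq0 -[X in X == _]mulr1 -fx1 mulX_natpolyE.
  rewrite (reindex_inj rev_ord_inj) /= mulr_sumr; apply/eqP/eq_bigr => j _.
  rewrite coef_poly ltn_ord mulrCA; congr (_ * _).
  have x0 : x != 0 by rewrite gt_eqF.
  rewrite subnSK // -[X in _ ^+ X * _](subnK (ltnW (ltn_ord j))) exprD mulrAC -exprMn mulVf //.
  by rewrite expr1n mul1r.
- by rewrite monicE lead_coefDl ?size_polyN // lead_coefXn.
apply/polyOverP=> i; rewrite coefB coefXn coef_poly.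
by apply: rpredB; [|case: ifP => _]; rewrite ?rpred0 // rpred_nat.
Qed.

End PositiveRoot.

(** * Simple minimal polynomials and roots of unity *)

Lemma aut_stable_prod (nu : {rmorphism algC -> algC}) (S : seq algC) :
  uniq S -> {in S, forall w, nu w \in S} -> nu (\prod_(w <- S) w) = \prod_(w <- S) w.
Proof.
move=> uS nuS; rewrite rmorph_prod -(big_map nu xpredT id) /=.
have uM : uniq (map nu S) by rewrite map_inj_uniq //; apply: fmorph_inj.
have sub : {subset map nu S <= S} by move=> _ /mapP[w Sw ->]; apply: nuS.
apply: perm_big; apply: uniq_perm => //.
by case: (uniq_min_size uM sub); rewrite ?size_map.
Qed.

Lemma comp_poly_Xn_sparse (R : comNzRingType) (e : nat) (p : {poly R}) :
  (0 < e)%N -> (forall i, p`_i != 0 -> (e %| i)%N) ->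
  p = (\poly_(i < size p) p`_(e * i)) \Po 'X^e.
Proof.
move=> e_gt0 pe; apply/polyP=> i; rewrite coef_comp_poly_Xn //.
case: ifP => [/dvdnP[k ->]|nei]; last first.
  by apply/eqP; move: nei; apply: contraFT => /pe.
rewrite mulnK // coef_poly mulnC; case: ltnP => // pk.
by rewrite nth_default // (leq_trans pk) // leq_pmull.
Qed.

Lemma coef_comp_polyZX (R : comNzRingType) (p : {poly R}) (c : R) i :
  (p \Po (c *: 'X))`_i = p`_i * c ^+ i.
Proof.
rewrite comp_polyE.
have -> : \sum_(j < size p) p`_j *: (c *: 'X) ^+ j
        = \poly_(j < size p) (p`_j * c ^+ j).
  by rewrite poly_def; apply: eq_bigr => j _; rewrite exprZn scalerA.
by rewrite coef_poly; case: ltnP => // pi; rewrite nth_default ?mul0r.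
Qed.

(* The conjugates z of x with z^g = x^g form a set S that is stable under
   complex conjugation and under every automorphism mapping x into S. So the
   product of S is +-x^e with e = #|S|, whence z^e = x^e on S and S consists of
   all the e-th roots of x^e. By transitivity of the automorphisms the conjugates
   of x are stable under multiplication by e-th roots of unity. *)
Lemma simple_conjugate_expr_eq (x z : algC) (g : nat) :
    0 < x -> (0 < g)%N -> simple_poly (minQpoly x) ->
  conjugate x z -> z ^+ g = x ^+ g -> z = x.
Proof.
move=> x_gt0 g_gt0 [sz_m simple_m] xz zg.
have xR : x \is Num.real := gtr0_real x_gt0.
have x0 : x != 0 by rewrite gt_eqF.
have [rs urs Drs] := minCpoly_roots x.
have rsP w : (w \in rs) = conjugate x w by rewrite /conjugate Drs root_prod_XsubC.
pose S := [seq w <- rs | w ^+ g == x ^+ g].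
have SP w : (w \in S) = conjugate x w && (w ^+ g == x ^+ g).
  by rewrite mem_filter rsP andbC.
have uS : uniq S by rewrite filter_uniq.
have Sx : x \in S by rewrite SP eqxx andbT /conjugate root_minCpoly.
have conjx : x^* = x by apply/CrealP.
have nuS (nu : {rmorphism algC -> algC}) : nu x \in S ->
    {in S, forall w, nu w \in S}.
  rewrite SP => /andP[_ /eqP nux] w; rewrite !SP => /andP[xw /eqP wg].
  rewrite -rmorphXn wg rmorphXn nux eqxx andbT.
  by have [mu <-] := conjugate_aut xw; apply: (aut_conjugate (nu \o mu)).
pose e := size S; pose c := \prod_(w <- S) w.
have e_gt0 : (0 < e)%N by rewrite /e; case: (S) Sx.
have nuc (nu : {rmorphism algC -> algC}) : nu x \in S -> nu c = c.
  by move=> nux; apply: aut_stable_prod => //; apply: nuS.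
have cR : c \is Num.real.
  by apply/CrealP; apply: (nuc (Num.conj : {rmorphism algC -> algC})); rewrite /= conjx.
have norm_c : `|c| = x ^+ e.
  rewrite normr_prod /e -sum1_size -prodrXr; apply: eq_big_seq => w.
  rewrite SP => /andP[_ /eqP wg]; rewrite expr1; apply/eqP.
  by rewrite -(eqrXn2 g_gt0) ?(ltW x_gt0) // -normrX wg ger0_norm ?exprn_ge0 ?ltW.
(* An automorphism sending [x] to [w] fixes [c], which is a sign times x^e; the sign cancels. *)
have Se w : w \in S -> w ^+ e = x ^+ e.
  move=> Sw; move: (Sw); rewrite SP => /andP[/conjugate_aut[nu Dw] _].
  have := nuc nu; rewrite Dw (realEsign cR) norm_c rmorphMsign rmorphXn Dw.
  by move=> /(_ Sw)/lreg_sign.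
(* Otherwise X^e - x^e would have e + 1 distinct roots. *)
have eS w : w ^+ e = x ^+ e -> w \in S.
  move=> we; apply/idPn => nSw.
  have : (size (w :: S) < size ('X^e - (x ^+ e)%:P)%R)%N.
    apply: max_poly_roots; last by rewrite /= nSw.
      by rewrite -size_poly_gt0 size_XnsubC.
    apply/allP=> v; rewrite inE /root !hornerE subr_eq0.
    by case/predU1P=> [->|/Se->] //; apply/eqP.
  by rewrite size_XnsubC //= ltnn.
have [zeta prim_zeta] := C_prim_root_exists e_gt0.
have zeta0 : zeta != 0 by rewrite (prim_root_eq0 prim_zeta) -lt0n.
have rs_zeta w : w \in rs -> w * zeta \in rs.
  rewrite !rsP => /conjugate_aut[nu <-]; rewrite -[zeta](algC_invautK nu) -rmorphM.
  (* Pulled back by [nu], [zeta] is still an e-th root of unity, so [x * v] is a conjugate of [x];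
     [nu] then maps it to the required product. *)
  set v := algC_invaut nu zeta.
  have: x * v \in S.
    by apply: eS; rewrite exprMn /v -rmorphXn (prim_expr_order prim_zeta) rmorph1 mulr1.
  rewrite SP => /andP[/conjugate_aut[mu <-] _].
  exact: (aut_conjugate (nu \o mu)).
have perm_rs : perm_eq [seq w * zeta | w <- rs] rs.
  have uM : uniq [seq w * zeta | w <- rs] by rewrite map_inj_uniq //; apply: mulIf.
  have sub : {subset [seq w * zeta | w <- rs] <= rs}.
    by move=> _ /mapP[w rs_w ->]; apply: rs_zeta.
  apply: uniq_perm => //.
  by case: (uniq_min_size uM sub); rewrite ?size_map.
pose m := minCpoly x.
have m_zeta : m \Po (zeta *: 'X) = zeta ^+ size rs *: m.
  rewrite /m Drs -{1}(perm_big _ perm_rs) /= big_map rmorph_prod /=.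
  rewrite -sum1_size -prodrXr -scaler_prod; apply: eq_bigr => w _.
  by rewrite comp_polyB comp_polyX comp_polyC expr1 scalerBr mulrC -scale_polyC.
have m_coef i : m`_i != 0 -> (e %| i)%N.
  have m_i j : m`_j != 0 -> zeta ^+ j = zeta ^+ size rs.
    move=> mj; apply: (mulfI mj).
    by rewrite -coef_comp_polyZX m_zeta coefZ mulrC.
  (* The nonzero constant term shows that the common value of the powers of [zeta] is 1. *)
  have m0 : m`_0 != 0.
    rewrite -horner_coef0; apply/negP=> /(conjugate0 (x := x)).
    by rewrite eqxx => /(_ x0).
  by move=> /m_i; rewrite -(m_i 0%N m0) => /eqP; rewrite expr0 -(prim_order_dvd prim_zeta).
have mQ_coef i : (minQpoly x)`_i != 0 -> (e %| i)%N.
  move=> mi; apply: m_coef; rewrite /m; have [-> _ _] := minQpolyP x.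
  by rewrite coef_map fmorph_eq0.
have [e1 _] := simple_m e _ e_gt0 (comp_poly_Xn_sparse e_gt0 mQ_coef).
have Sz : z \in S by rewrite SP xz zg eqxx.
by have := Se z Sz; rewrite e1 !expr1.
Qed.

(** If the minimal polynomial is g(X^n) and zeta is a primitive n-th root of unity, then x zeta is a
    conjugate of the same modulus as x. Strict dominance forces zeta = 1. *)
Lemma perron_simple (x : algC) :
  0 < x -> perron x^-1 -> simple_poly (minQpoly x).
Proof.
move=> x_gt0 [_ _ perr]; split; first by rewrite size_minQpoly size_minCpoly.
move=> n g n_gt0 Dm; have [Dp _ _] := minQpolyP x.
suffices n1 : n = 1%N by split=> //; rewrite Dm n1 comp_polyXr.
have [zeta prim_zeta] := C_prim_root_exists n_gt0.
have zetan := prim_expr_order prim_zeta.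
have norm_zeta : `|zeta| = 1.
  by apply/eqP; rewrite -(pexpr_eq1 n_gt0 (normr_ge0 _)) -normrX zetan normr1.
have cz : conjugate x (x * zeta).
  have := root_minCpoly x.
  rewrite /conjugate Dp Dm map_comp_poly map_polyXn /root !horner_comp !hornerXn.
  by rewrite exprMn zetan mulr1.
have [E|ne] := eqVneq (x * zeta)^-1 x^-1.
  have z1 : zeta = 1.
    by move/invr_inj: E; rewrite -[RHS]mulr1; apply: mulfI; rewrite gt_eqF.
  have : (n %| 1)%N by rewrite (prim_order_dvd prim_zeta) z1 expr1.
  by rewrite dvdn1 => /eqP.
have := perr _ (conjugate_inv cz) ne.
by rewrite normfV normrM norm_zeta mulr1 gtr0_norm // ltxx.
Qed.

(** * Multiples with nonnegative or positive coefficients *)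

(* While Re w > 0, squaring w at least doubles the ratio (|w| - Re w) / |w|; once
   Re w <= 0, the quadratic with roots w and w^* has nonnegative coefficients. *)
Lemma nonneg_poly_root_Graeffe (k : nat) (w : algC) :
    w != 0 -> `|w| <= 2%:R ^+ k * (`|w| - 'Re w) ->
  exists G : {poly algC}, [/\ forall i, 0 <= G`_i, 0 < G`_0 & root G w].
Proof.
have base (u : algC) : u != 0 -> 'Re u <= 0 ->
    exists G : {poly algC}, [/\ forall i, 0 <= G`_i, 0 < G`_0 & root G u].
  move=> u0 Re_u; exists ('X^2 - ('Re u *+ 2)%:P * 'X + (`|u| ^+ 2)%:P).
  have nu0 : 0 < `|u| ^+ 2 by rewrite exprn_gt0 ?normr_gt0.
  split=> [i||].
  - rewrite !coefD coefN coefXn coefMX !coefC.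
    case: i => [|[|[|i]]] /=; rewrite ?oppr0 ?addr0 ?add0r ?subr0 ?ler01 //.
      exact: ltW.
    by rewrite oppr_ge0 mulrn_wle0.
  - by rewrite !coefD coefN coefXn coefMX !coefC /= oppr0 !add0r.
  apply/rootP; rewrite !hornerE normCK ReE mulr2n -splitr.
  by ring.
elim: k w => [|k IHk] w w0 wk.
  by apply: base => //; rewrite mul1r lerBrDl gerDr in wk.
have [Re_w|Re_w] := real_leP (Creal_Re w) (real0 _); first exact: base.
have [] := IHk (w ^+ 2).
- by rewrite expf_neq0.
(* Hence |w^2| - Re(w^2) = 2 (|w| - Re w)(|w| + Re w), where the last factor is at least |w|. *)
- have Dre : 'Re (w ^+ 2) = 'Re w ^+ 2 *+ 2 - `|w| ^+ 2.
    by rewrite normC2_Re_Im expr2 ReM; ring.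
  rewrite normrX Dre; set a := `|w| in wk *; set b := 'Re w in wk Re_w *.
  have a_ge0 : 0 <= a by apply: normr_ge0.
  have -> : 2%:R ^+ k * (a ^+ 2 - (b ^+ 2 *+ 2 - a ^+ 2)) =
            (2%:R ^+ k.+1 * (a - b)) * (a + b).
    by rewrite (exprS _ k); ring.
  apply: (@le_trans _ _ (a * (a + b))).
    by rewrite expr2 ler_wpM2l // lerDl ltW.
  by rewrite ler_wpM2r // addr_ge0 // ltW.
move=> G [G_ge0 G0 Gw]; exists (G \Po 'X^2); split=> [i||].
- by rewrite coef_comp_poly_Xn //; case: ifP.
- by rewrite coef_comp_poly_Xn.
by rewrite /root horner_comp hornerXn.
Qed.

Lemma nonneg_poly_root (w : algC) : w != 0 -> ~~ (0 < w) ->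
  exists G : {poly algC}, [/\ forall i, 0 <= G`_i, 0 < G`_0 & root G w].
Proof.
move=> w0 w_npos; have d_gt0 : 0 < `|w| - 'Re w.
  rewrite subr_gt0 lt_neqAle !leif_Re_Creal andbT.
  by apply: contra w_npos; rewrite lt_def w0.
have q_ge0 : 0 <= `|w| / (`|w| - 'Re w) by rewrite divr_ge0 // ltW.
(* By k < 2^k, the archimedean bound serves as the number of squarings. *)
pose k := Num.bound (`|w| / (`|w| - 'Re w)).
apply: (@nonneg_poly_root_Graeffe k) => //.
rewrite -ler_pdivrMr //; apply: le_trans (ltW (archi_boundP q_ge0)) _.
by rewrite -natrX ler_nat ltnW // ltn_expl.
Qed.

Lemma nonneg_poly_multiple (rs : seq algC) :
    {in rs, forall w, w != 0 /\ ~~ (0 < w)} ->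
  exists G : {poly algC}, [/\ forall i, 0 <= G`_i, 0 < G`_0
    & \prod_(w <- rs) ('X - w%:P) %| G].
Proof.
elim: rs => [|w rs IHrs] rs_w.
  exists 1; rewrite big_nil dvdpp coef1; split=> // i.
  by rewrite coef1 ler0n.
have [G [G_ge0 G0 Gd]] := IHrs (fun v rv => rs_w v (mem_behead (s := w :: rs) rv)).
have [w0 wn] := rs_w w (mem_head w rs).
have [H [H_ge0 H0 Hd]] := nonneg_poly_root w0 wn.
exists (H * G); split=> [i||].
- by rewrite coefM sumr_ge0 // => j _; rewrite mulr_ge0.
- by rewrite coef0M mulr_gt0.
by rewrite big_cons dvdp_mul // dvdp_XsubCl.
Qed.

(** Multiplying the nonnegative multiple G by 1 + X + ... + X^k, where k is the size of G, fills all
    gaps: low coefficients receive the constant term of G, high ones its leading coefficient.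
    Scaling normalizes the value at x. *)
Lemma pos_poly_multiple (x : algC) (rs : seq algC) : 0 < x ->
    {in rs, forall w, w != 0 /\ ~~ (0 < w)} ->
  exists F : {poly algC}, [/\ (1 < size F)%N, forall i, (i < size F)%N -> 0 < F`_i,
    F.[x] = 1 & \prod_(w <- rs) ('X - w%:P) %| F].
Proof.
move=> x_gt0 /nonneg_poly_multiple[G [G_ge0 G0 dvdG]].
have nzG : G != 0 by apply: contraTneq G0 => ->; rewrite coef0 ltxx.
have szG : (0 < size G)%N by rewrite lt0n size_poly_eq0.
pose k := size G; pose H : {poly algC} := \poly_(i < k.+1) 1.
have szH : size H = k.+1 by rewrite size_poly_eq ?oner_eq0.
have nzH : H != 0 by rewrite -size_poly_eq0 szH.
have szF : size (G * H)%R = (k + k)%N by rewrite size_mul // szH addnS.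
have lead_gt0 : 0 < G`_k.-1.
  by rewrite lt_def G_ge0 -/(lead_coef G) lead_coef_eq0 nzG.
have F_gt0 i : (i < size (G * H)%R)%N -> 0 < (G * H)`_i.
  rewrite szF => lt_i.
  have H_coef j : (j <= k)%N -> H`_j = 1 by move=> lt_j; rewrite coef_poly ltnS lt_j.
  have GH_ge0 (j : 'I_i.+1) : 0 <= G`_j * H`_(i - j).
    by rewrite mulr_ge0 // coef_poly; case: ifP; rewrite ?ler01.
  have [j [Gj le_ji le_ij]] : exists j, [/\ 0 < G`_j, (j <= i)%N & (i - j <= k)%N].
    have [ik|ki] := leqP i k; first by exists 0%N; rewrite subn0.
    exists k.-1; split=> //; first by rewrite (leq_trans (leq_pred _)) // ltnW.
    by rewrite leq_subLR -ltnS -addSn prednK.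
  have lt_j : (j < i.+1)%N by [].
  rewrite coefM (bigD1 (Ordinal lt_j)) //= H_coef // mulr1.
  by rewrite ltr_wpDr // sumr_ge0.
have Fx_gt0 : 0 < (G * H).[x].
  have sz0 : (0 < size (G * H)%R)%N by rewrite szF addn_gt0 /k szG.
  rewrite horner_coef (bigD1 (Ordinal sz0)) //= expr0 mulr1.
  rewrite ltr_wpDr ?F_gt0 // sumr_ge0 // => i _.
  by rewrite mulr_ge0 ?exprn_ge0 ?ltW ?F_gt0.
have c_gt0 : 0 < (G * H).[x]^-1 by rewrite invr_gt0.
exists ((G * H).[x]^-1 *: (G * H)); split=> [|i||].
- by rewrite size_scale ?gt_eqF // szF (leq_add szG szG).
- by rewrite size_scale ?gt_eqF // => /F_gt0 Fi; rewrite coefZ mulr_gt0.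
- by rewrite hornerZ mulVf // gt_eqF.
by rewrite dvdpZr ?gt_eqF // dvdp_mulr.
Qed.

(** * Geometric estimates *)

Lemma bernoulli_le (h : algC) (n : nat) : 0 <= h -> 1 + h *+ n <= (1 + h) ^+ n.
Proof.
move=> h0; elim: n => [|n IHn]; first by rewrite mulr0n addr0.
rewrite exprSr; apply: le_trans (ler_wpM2r _ IHn); last by rewrite addr_ge0.
rewrite mulrDr mulr1 mulrDl mul1r -addrA lerD2l mulrS addrC lerD2l lerDl.
by rewrite mulr_ge0 // mulrn_wge0.
Qed.

Lemma geometric_lt_eventually (r B d : algC) : 0 < r -> r < 1 -> 0 <= B -> 0 < d ->
  exists N : nat, forall n, (N <= n)%N -> r ^+ n * B < d.
Proof.
move=> r0 r1 B0 d0; pose h := r^-1 - 1.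
have h0 : 0 < h by rewrite subr_gt0 invf_gt1.
have q0 : 0 <= B / d / h by rewrite !divr_ge0 ?(ltW d0) ?(ltW h0).
exists (Num.bound (B / d / h)) => n le_n.
rewrite -ltr_pdivlMl ?exprn_gt0 // -exprVn -ltr_pdivrMr //.
apply: (@lt_le_trans _ _ (h *+ n)).
  rewrite -mulr_natl -ltr_pdivrMr //; apply: lt_le_trans (archi_boundP q0) _.
  by rewrite ler_nat.
have -> : r^-1 = 1 + h by rewrite addrC subrK.
by apply: le_trans (bernoulli_le n (ltW h0)); rewrite lerDr.
Qed.

Lemma geometric_lt_eventually_all (r : algC) (B d : nat -> algC) (k : nat) :
    0 < r -> r < 1 -> (forall i, 0 <= B i) -> (forall i, (i < k)%N -> 0 < d i) ->
  exists N : nat, forall n, (N <= n)%N -> forall i, (i < k)%N -> r ^+ n * B i < d i.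
Proof.
move=> r0 r1 B0; elim: k => [|k IHk] d0; first by exists 0%N.
have [i ik|N1 HN1] := IHk; first exact/d0/ltnW.
have [N2 HN2] := geometric_lt_eventually r0 r1 (B0 k) (d0 k (leqnn _)).
exists (maxn N1 N2) => n; rewrite geq_max => /andP[n1 n2] i.
by rewrite ltnS leq_eqVlt => /predU1P[->|]; [exact: HN2 | exact: HN1].
Qed.

(** This turns the strict dominance of a Perron number over its finitely many conjugates into one
    geometric rate. *)
Lemma common_ratio (b : algC) (s : seq algC) : 0 < b ->
    {in s, forall u, 0 <= u < b} ->
  exists2 r, 0 < r < 1 & {in s, forall u, u <= r * b}.
Proof.
move=> b0; elim: s => [|u s IHs] su.
  by exists 2^-1 => //; rewrite invr_gt0 ltr0n invf_lt1 ?ltr0n ?ltr1n.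
have [v sv|r /andP[r0 r1] rs] := IHs; first by apply: su; rewrite inE sv orbT.
have /andP[u0 ub] := su u (mem_head _ _).
have uR : u / b \is Num.real by rewrite ger0_real // divr_ge0 // ltW.
have [ur|ru] := real_leP uR (gtr0_real r0).
  exists r; rewrite ?r0 // => v; rewrite inE => /predU1P[-> | /rs //].
  by rewrite -ler_pdivrMr.
exists (u / b); first by rewrite (lt_trans r0 ru) ltr_pdivrMr // mul1r.
move=> v; rewrite inE divfK ?(gt_eqF b0) // => /predU1P[-> // | /rs v_le].
by apply: le_trans v_le _; rewrite -ler_pdivlMr // ltW.
Qed.

(** * Lagrange interpolation *)

Section Lagrange.

Variables (F : fieldType) (rs : seq F).
Hypothesis urs : uniq rs.

Definition lagrange_poly (z : F) : {poly F} :=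
  (\prod_(w <- rs | w != z) (z - w))^-1 *: \prod_(w <- rs | w != z) ('X - w%:P).

Lemma lagrange_polyE z w : z \in rs -> w \in rs -> (lagrange_poly z).[w] = (z == w)%:R.
Proof.
move=> rz rw; rewrite hornerZ horner_prod.
under [X in _ * X]eq_bigr do rewrite hornerXsubC.
have [<-|ne] := eqVneq z w.
  rewrite mulVf //; rewrite prodf_seq_neq0; apply/allP=> v _.
  by apply/implyP=> vz; rewrite subr_eq0 eq_sym.
apply/eqP; rewrite mulf_eq0; apply/orP; right; rewrite prodf_seq_eq0.
by apply/hasP; exists w; rewrite // subrr eqxx eq_sym ne.
Qed.

Lemma size_lagrange_poly z : z \in rs -> (size (lagrange_poly z) <= size rs)%N.
Proof.
move=> rz; apply: leq_trans (size_scale_leq _ _) _.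
rewrite -big_filter size_prod_XsubC size_filter.
rewrite -(count_predC (pred1 z) rs) (count_uniq_mem _ urs) rz add1n ltnS.
exact: sub_count.
Qed.

Lemma lagrange_interpolation (p : {poly F}) : (size p <= size rs)%N ->
  p = \sum_(z <- rs) p.[z] *: lagrange_poly z.
Proof.
move=> sz_p; apply/eqP; rewrite -subr_eq0; apply/eqP.
apply: (roots_geq_poly_eq0 _ urs) => /=.
  apply/allP=> w rw; rewrite /root hornerD hornerN horner_sum (bigD1_seq w) //=.
  rewrite hornerZ lagrange_polyE // eqxx mulr1 big_seq_cond big1 ?addr0 ?subrr //.
  by move=> z /andP[rz zw]; rewrite hornerZ lagrange_polyE // (negPf zw) mulr0.
apply: leq_trans (size_polyD _ _) _; rewrite geq_max sz_p size_polyN big_seq.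
apply: (big_ind (fun q : {poly F} => size q <= size rs)%N) => [|q1 q2 H1 H2|z rz]; first by rewrite size_poly0.
  by apply: leq_trans (size_polyD _ _) _; rewrite geq_max H1.
exact: leq_trans (size_scale_leq _ _) (size_lagrange_poly rz).
Qed.

End Lagrange.

(** * Positive expansions of powers of a Perron number *)

Lemma map_polyC_real_mulI (p q : {poly algC}) : p != 0 ->
    map_poly (Num.conj : algC -> algC) p = p ->
    map_poly (Num.conj : algC -> algC) (q * p) = q * p ->
  map_poly (Num.conj : algC -> algC) q = q.
Proof. by move=> p0 cp; rewrite rmorphM /= cp => /(mulIf p0). Qed.

(** Division by b^n will turn the relation into x f(x) = 1 for the inverse x of b, and the two
    adjacent positive coefficients will make the resulting polynomial simple. *)
Lemma perron_power_expansion (b : algC) :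
    perron b -> (forall z, conjugate b z -> 0 < z -> z = b) ->
  exists (E : {poly int}) (n : nat),
    [/\ (size E <= n)%N, forall i, 0 <= E`_i, 0 < E`_0, 0 < E`_1
      & b ^+ n = (map_poly intr E).[b]].
Proof.
move=> [b_int b_gt1 b_max] b_pos.
have b_gt0 : 0 < b by apply: lt_trans b_gt1; apply: ltr01.
have b0 : b != 0 by rewrite gt_eqF.
have [rs urs Drs] := minCpoly_roots b; set m := minCpoly b in Drs.
have rsP w : (w \in rs) = conjugate b w by rewrite /conjugate -/m Drs root_prod_XsubC.
have rs_b : b \in rs by rewrite rsP /conjugate root_minCpoly.
have [mz Dmz] : exists mz : {poly int}, m = map_poly intr mz.
  by have /floorpP[mz Dz] := b_int; exists mz.
have mon_mz : mz \is monic.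
  have intrI : injective (intr : int -> algC) by apply: intr_inj.
  rewrite monicE -(inj_eq intrI) -(lead_coef_map_inj intrI) // -Dmz.
  by rewrite (monicP (minCpoly_monic b)).
have m0 : m != 0 by rewrite monic_neq0 // minCpoly_monic.
have sz_mz : size mz = (size rs).+1.
  have -> : size mz = size m by rewrite Dmz size_map_inj_poly //; apply: intr_inj.
  by rewrite Drs size_prod_XsubC.
pose rs0 := [seq w <- rs | w != b].
have rs0P w : (w \in rs0) = (w != b) && conjugate b w by rewrite mem_filter rsP.
pose Q : {poly algC} := \prod_(w <- rs0) ('X - w%:P).
have DQ : m = Q * ('X - b%:P).
  by rewrite Drs (bigD1_seq b) //= mulrC /Q big_filter.
have [F [szF F_gt0 Fb QF]] : exists F : {poly algC},
    [/\ (1 < size F)%N, forall i, (i < size F)%N -> 0 < F`_i, F.[b] = 1 & Q %| F].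
  apply: pos_poly_multiple => // w; rewrite rs0P => /andP[wb bw].
  split; first exact: conjugate0 bw.
  by apply: contraNN wb => /(b_pos w bw) ->.
pose L := lagrange_poly rs b.
(* Invariance under complex conjugation passes from [m] to [Q], [L] and [t]; the coefficients of [t]
   must be real to be rounded. *)
have cm : map_poly (Num.conj : algC -> algC) m = m.
  rewrite Dmz -map_poly_comp; apply: eq_map_poly => i /=.
  by rewrite rmorph_int.
have cb : Num.conj b = b by apply/CrealP; apply: gtr0_real.
have cX : map_poly (Num.conj : algC -> algC) ('X - b%:P) = 'X - b%:P.
  by rewrite map_polyXsubC /= cb.
have cQ : map_poly (Num.conj : algC -> algC) Q = Q.
  by apply: map_polyC_real_mulI cX _; rewrite ?polyXsubC_eq0 // -DQ.
have DL : L = Q.[b]^-1 *: Q.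
  rewrite /L /lagrange_poly /Q !big_filter horner_prod; congr (_^-1 *: _).
  by apply: eq_bigr => w _; rewrite hornerXsubC.
have cL : map_poly (Num.conj : algC -> algC) L = L.
  rewrite DL map_polyZ /= cQ fmorphV; congr (_^-1 *: _).
  by rewrite -[in LHS]horner_map /= cQ cb.
have cF : map_poly (Num.conj : algC -> algC) F = F.
  apply/polyP=> i; rewrite coef_map /=; apply/CrealP.
  by case: (ltnP i (size F)) => [/F_gt0/gtr0_real//|/leq_sizeP->].
(* [F] and [L] both take the value 1 at [b] and 0 at the other roots of [m], which are simple. *)
have [t Dt] : exists t, F - L = t * m.
  apply/dvdpP; rewrite Drs; apply: uniq_roots_dvdp; rewrite ?uniq_rootsE //.
  apply/allP=> w rw; rewrite /root hornerD hornerN lagrange_polyE //.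
  have [<-|wb] := eqVneq b w; first by rewrite Fb subrr.
  rewrite subr0 -/(root F w); have /dvdpP[q ->] := QF.
  by rewrite rootM root_prod_XsubC rs0P eq_sym wb -rsP rw orbT.
have ct : map_poly (Num.conj : algC -> algC) t = t.
  by apply: map_polyC_real_mulI cm _ => //; rewrite -Dt rmorphB /= cF cL.
have tR i : t`_i \is Num.real.
  by apply/CrealP; rewrite -{2}ct coef_map.
(* The entry 1 ensures [1 <= r * b], so that the bounded rounding error is also controlled by the
   n-th power of [r * b]. *)
have [r /andP[r_gt0 r_lt1] r_max] : exists2 r, 0 < r < 1 &
    {in 1 :: [seq `|w| | w <- rs0], forall u, u <= r * b}.
  apply: common_ratio => // u; rewrite inE => /predU1P[->|]; first by rewrite ler01.
  by case/mapP=> w; rewrite rs0P => /andP[wb bw] ->; rewrite normr_ge0 b_max.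
pose B i := \sum_(z <- rs0) `|(lagrange_poly rs z)`_i| + \sum_(j < i.+1) `|m`_j|.
have B_ge0 i : 0 <= B i by rewrite addr_ge0 // sumr_ge0.
have [N HN] := geometric_lt_eventually_all r_gt0 r_lt1 B_ge0 F_gt0.
(* [N] makes the coefficients positive; [size F] bounds the size of [E]. *)
pose n := maxn N (size F); pose x := r * b.
pose A := Pdiv.Ring.rmodp 'X^n mz.
pose K : {poly int} := \poly_(i < size t) Num.floor (b ^+ n * t`_i).
pose E := A + K * mz.
have intrI : injective (intr : int -> algC) by apply: intr_inj.
have A_root w : w \in rs -> (map_poly intr A).[w] = w ^+ n.
  move=> rw; have /(congr1 (map_poly (intr : int -> algC))) := Pdiv.RingMonic.rdivp_eq mon_mz 'X^n.
  rewrite map_polyXn rmorphD rmorphM /= -Dmz => /(congr1 (horner^~ w)).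
  rewrite hornerXn hornerD hornerM -/A.
  have /rootP-> : root m w by rewrite Drs root_prod_XsubC.
  by rewrite mulr0 add0r.
have sz_A : (size A <= size rs)%N.
  by rewrite -ltnS -sz_mz Pdiv.Ring.ltn_rmodpN0 // monic_neq0.
have DA : map_poly intr A = b ^+ n *: L + \sum_(z <- rs0) z ^+ n *: lagrange_poly rs z.
  rewrite [LHS](lagrange_interpolation urs) ?size_map_inj_poly //.
  rewrite (bigD1_seq b) //= A_root // /rs0 big_filter; congr (_ + _).
  rewrite big_seq_cond [RHS]big_seq_cond; apply: eq_bigr => z /andP[rz _].
  by rewrite A_root.
pose D : {poly algC} := b ^+ n *: t - map_poly intr K.
have D_le1 i : `|D`_i| <= 1.
  have bt : b ^+ n * t`_i \is Num.real by rewrite rpredM // rpredX // gtr0_real.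
  rewrite coefB coefZ coef_map coef_poly /=; case: ltnP => [_|ti]; last first.
    by rewrite [t`_i]nth_default // mulr0 subr0 normr0 ler01.
  have /andP[le1 le2] := real_floor_itv bt.
  rewrite ger0_norm ?subr_ge0 //.
  by rewrite lerBlDl; rewrite intrD in le2; apply: ltW.
(* The main terms combine as b^n L + b^n t m = b^n F; what remains comes from the other conjugates
   and from the rounding. *)
have DE : map_poly intr E =
    b ^+ n *: F + \sum_(z <- rs0) z ^+ n *: lagrange_poly rs z - D * m.
  rewrite rmorphD rmorphM /= -Dmz DA /D mulrBl -scalerAl -Dt scalerBr.
  rewrite opprB opprD opprK [X in _ = _ + X]addrC addrA.
  by rewrite addrACA subrr add0r [_ + b ^+ n *: L]addrC.
have E_pos i : (i < size F)%N -> 0 < E`_i.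
  move=> lt_i; have Fi := F_gt0 i lt_i.
  have bn_gt0 : 0 < b ^+ n by rewrite exprn_gt0.
  pose err := \sum_(z <- rs0) z ^+ n * (lagrange_poly rs z)`_i - (D * m)`_i.
  have Ei : (E`_i)%:~R = b ^+ n * F`_i + err.
    have := congr1 (fun p : {poly algC} => p`_i) DE.
    rewrite /= coef_map /= => ->; rewrite coefB coefD coefZ coef_sum /err addrA.
    by congr (_ + _ - _); apply: eq_bigr => z _; rewrite coefZ.
  have err_le : `|err| <= (x ^+ n) * B i.
    have x_ge z : z \in rs0 -> `|z| <= x.
      by move=> rz; apply: r_max; rewrite inE map_f ?orbT.
    have x_ge1 : 1 <= x by apply: r_max; rewrite inE eqxx.
    rewrite mulrDr; apply: le_trans (ler_normB _ _) _; apply: lerD.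
      apply: le_trans (ler_norm_sum _ _ _) _; rewrite mulr_sumr.
      rewrite big_seq_cond [leRHS]big_seq_cond; apply: ler_sum => z /andP[rz _].
      by rewrite normrM normrX ler_wpM2r // lerXn2r ?nnegrE ?x_ge // (le_trans ler01).
    rewrite coefMr; apply: le_trans (ler_norm_sum _ _ _) _; rewrite mulr_sumr.
    apply: ler_sum => j _; rewrite normrM ler_wpM2r //.
    by rewrite (le_trans (D_le1 _)) // exprn_ege1.
  have err_lt : `|err| < b ^+ n * F`_i.
    apply: le_lt_trans err_le _; rewrite /x exprMn mulrAC mulrC ltr_pM2l //.
    by apply: HN => //; apply: leq_maxl.
  have errR : err \is Num.real.
    have -> : err = (E`_i)%:~R - b ^+ n * F`_i by rewrite Ei addrC addKr.
    by apply: rpredB; [apply: realz | apply: rpredM; apply: gtr0_real].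
  rewrite -(ltr0z algC) Ei -ltrBlDr sub0r.
  by apply: le_lt_trans err_lt; rewrite -normrN real_ler_norm ?rpredN.
(* [A] is smaller than [m], hence no larger than [Q], a divisor of [F]; rounding [t] gives [K * mz]
   at most the size of [t * m], which is [F - L]. *)
have E_size : (size E <= size F)%N.
  have F0 : F != 0 by rewrite -size_poly_gt0 ltnW.
  have szQ : size Q = size rs.
    apply: succn_inj; rewrite -sz_mz -(size_map_inj_poly intrI) // -Dmz DQ.
    by rewrite size_Mmonic ?monicXsubC ?size_XsubC ?addn2 // -size_poly_gt0 size_prod_XsubC.
  have le_rsF : (size rs <= size F)%N by rewrite -szQ dvdp_leq.
  rewrite (leq_trans (size_polyD _ _)) // geq_max (leq_trans sz_A) //=.
  have [t0|t0] := eqVneq t 0.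
    have -> : K = 0 by rewrite /K t0 size_poly0 poly_def big_ord0.
    by rewrite mul0r size_poly0.
  apply: leq_trans (size_polyMleq _ _) _; apply: (@leq_trans (size (t * m))).
    rewrite size_mul // [size m](_ : _ = size mz).
      by rewrite -!subn1 leq_sub2r // leq_add2r size_poly.
    by rewrite Dmz size_map_inj_poly.
  rewrite -Dt (leq_trans (size_polyD _ _)) // geq_max leqnn size_polyN.
  by rewrite (leq_trans (size_lagrange_poly urs rs_b)).
exists E, n; split.
- exact: leq_trans E_size (leq_maxr _ _).
- move=> i; case: (ltnP i (size F)) => [/E_pos/ltW//|iF].
  by rewrite nth_default // (leq_trans E_size).
- by apply: E_pos; apply: ltnW.
- exact: E_pos.
rewrite rmorphD rmorphM /= -Dmz hornerD hornerM A_root //.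
by have /rootP-> : root m b; rewrite ?root_minCpoly // mulr0 addr0.
Qed.

(** * Simple multiples and the equivalences *)

Lemma ratr_natpoly (f : {poly nat}) :
  map_poly ratr ('X * natpoly rat f - 1) = 'X * natpoly algC f - 1 :> {poly algC}.
Proof.
rewrite rmorphB rmorphM rmorph1 /= map_polyX; congr (_ * _ - _).
by apply/polyP=> i; rewrite coef_map !coef_map_id0 //= ratr_nat.
Qed.

Lemma root_natpoly_dvd (x : algC) (f : {poly nat}) :
  (minQpoly x %| 'X * natpoly rat f - 1) = (x * (natpoly algC f).[x] == 1).
Proof.
have [_ _ <-] := minQpolyP x.
by rewrite ratr_natpoly /root hornerD hornerN hornerM hornerX hornerC subr_eq0.
Qed.

(** For a polynomial in X^k, the exponent k divides both n and n + 1. *)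
Lemma consecutive_coef_simple (p : {poly rat}) (n : nat) :
  (0 < n)%N -> p`_n != 0 -> p`_n.+1 != 0 -> simple_poly p.
Proof.
move=> n_gt0 pn pn1; split.
  rewrite ltnNge; apply/negP=> sz_p; move/eqP: pn; apply.
  by rewrite nth_default // (leq_trans sz_p).
move=> k g k_gt0 Dp.
suffices k1 : k = 1%N by split=> //; rewrite Dp k1 comp_polyXr.
have dvd i : p`_i != 0 -> (k %| i)%N.
  by rewrite Dp coef_comp_poly_Xn //; case: ifP => //; rewrite eqxx.
have := dvd _ pn1; rewrite -addn1 (dvdn_addr _ (dvd _ pn)) dvdn1.
by move/eqP.
Qed.

Lemma simple_antimatter_perron (x : algC) : 0 < x -> x < 1 ->
    simple_monoidM x -> antimatter (monoidM x) ->
  perron x^-1 /\ (forall z, conjugate x^-1 z -> 0 < z -> z = x^-1).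
Proof.
move=> x_gt0 x_lt1 simple_x /(antimatter_root x_gt0)[f fx1].
split; last first.
  move=> z /conjugate_invl xz z_gt0; rewrite -[z]invrK; congr (_^-1).
  by apply: (conjugate_pos_eq x_gt0 fx1 xz); rewrite invr_gt0.
split; [exact: natpoly_root_Aint fx1 | by rewrite invf_gt1 | ].
move=> z /conjugate_invl xz z_ne; have x0 : x != 0 by rewrite gt_eqF.
have z0 : z != 0 by rewrite -invr_eq0 (conjugate0 x0 xz).
have := conjugate_norm_ge x_gt0 fx1 xz.
rewrite le_eqVlt => /predU1P[Exz|]; last first.
  by rewrite normfV => lt_xz; rewrite -[`|z|]invrK ltf_pV2 ?posrE ?invr_gt0 ?normr_gt0.
case/eqP: z_ne; rewrite -[z]invrK; congr (_^-1).
(* The exponent comes from the leading term of x f(x). *)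
apply: (@simple_conjugate_expr_eq _ _ (size f).-1.+1) => //.
apply: (conjugate_norm_eq fx1 xz (esym Exz)).
by rewrite -/(lead_coef f) lead_coef_eq0 (natpoly_root_neq0 fx1).
Qed.

(** Dividing b^n = E(b) by b^n reverses the coefficients of [E], so those of index 1 and 0 land in
    degrees n - 1 and n. *)
Lemma perron_simple_multiple (x : algC) : 0 < x ->
    perron x^-1 -> (forall z, conjugate x^-1 z -> 0 < z -> z = x^-1) ->
  exists p : {poly rat}, [/\ minQpoly x %| p, simple_poly p & in_xN0x_minus1 p].
Proof.
move=> x_gt0 perr pos; have [E [n [szE E_ge0 E0 E1 En]]] := perron_power_expansion perr pos.
pose e i : nat := absz (E`_i)%R.
have e_neq0 i : 0 < E`_i -> e i != 0%N by rewrite absz_eq0; move/gt_eqF->.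
(* This makes the lower of the two adjacent degrees positive. *)
have n_ge2 : (1 < n)%N.
  apply: leq_trans szE; rewrite ltnNge; apply/negP=> szE1.
  by move: E1; rewrite nth_default ?ltxx.
pose f : {poly nat} := \poly_(i < n) e (n - i.+1)%N.
have f_coef i : (i < n)%N -> f`_i = e (n - i.+1)%N by move=> lt_i; rewrite coef_poly lt_i.
exists ('X * natpoly rat f - 1); split; last by exists f.
- rewrite root_natpoly_dvd; have x0 : x != 0 by rewrite gt_eqF.
  have -> : (natpoly algC f).[x] = \sum_(i < n) (f`_i)%R%:R * x ^+ i.
    rewrite (@horner_coef_wide _ n).
      by apply: eq_bigr => i _; rewrite coef_map_id0.
    by apply: leq_trans (size_poly _ _) (size_poly _ _).
  apply/eqP; rewrite -[RHS](mulVf (expf_neq0 n x0)) -exprVn En.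
  rewrite (@horner_coef_wide _ n); last by rewrite (leq_trans (size_poly _ _)).
  rewrite mulr_sumr mulr_suml [RHS](reindex_inj rev_ord_inj) /=.
  apply: eq_bigr => i _; rewrite coef_map /= f_coef // mulrCA -exprS -mulrA.
  congr (_ * _); first by rewrite -[X in _ = X%:~R]gez0_abs.
  rewrite -[X in _ = _ * x ^+ X](subnK (ltn_ord i)) exprD mulrA -exprMn mulVf //.
  by rewrite expr1n mul1r.
have p_coef k : (k < n)%N -> e (n - k.+1)%N != 0%N ->
    ('X * natpoly rat f - 1)`_k.+1 != 0.
  move=> lt_k Ek.
  by rewrite coefB coefXM coef1 subr0 /= coef_map_id0 // f_coef // pnatr_eq0.
apply: (@consecutive_coef_simple _ n.-1).
- by rewrite -subn1 subn_gt0.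
- have D1 : n.-2.+1 = n.-1 by rewrite prednK // -subn1 subn_gt0.
  rewrite -D1; apply: p_coef; first by rewrite D1 leq_pred.
  by rewrite D1 -subn1 subKn ?e_neq0 // ltnW.
have Dn : n.-1.+1 = n by rewrite prednK // ltnW.
by apply: p_coef; rewrite Dn ?subnn ?e_neq0.
Qed.

Theorem theorem4p5 (alpha : algC) (alpha_gt0 : 0 < alpha) (alpha_lt1 : alpha < 1) :
  let a := simple_monoidM alpha /\ antimatter (monoidM alpha) in
  let b := perron alpha^-1 /\
           (forall z : algC, conjugate alpha^-1 z -> 0 < z -> z = alpha^-1) in
  let c := perron alpha^-1 /\
           (exists p : {poly rat},
              [/\ minQpoly alpha %| p, simple_poly p & in_xN0x_minus1 p]) in
  (a <-> b) /\ (b <-> c).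
Proof.
move=> a b c.
have ab : a -> b by case; apply: simple_antimatter_perron.
have bc : b -> c.
  by move=> [perr pos]; split=> //; apply: perron_simple_multiple.
(* Dominance yields simplicity, and the multiple of the form x f(x) - 1 yields the absence of
   atoms. *)
have ca : c -> a.
  move=> [perr [p [p_dvd _ [f Dp]]]]; split; first exact: perron_simple.
  apply: (@root_antimatter _ f) => //; apply/eqP.
  by rewrite -root_natpoly_dvd -Dp.
split; split=> //; first by move/bc/ca.
by move/ca/ab.
Qed.
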